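(* Let $(A,\nwarrow,\nearrow,\alpha)$ be a real $3$-Hom-L-dendriform algebra and let $J$ be an almost complex structure on $A$ (a linear map $J:A\to A$ with $J^2=-\mathrm{id}_A$) commuting with $\alpha$. If for all $x,y,z\in A$ $$\nwarrow(x,y,z)=\nwarrow(x,Jy,Jz)+\nwarrow(Jx,y,Jz)+\nwarrow(Jx,Jy,z),$$ $$\nearrow(x,y,z)=\nearrow(x,Jy,Jz)+\nearrow(Jx,y,Jz)+\nearrow(Jx,Jy,z),$$ then $J$ is a complex structure on $A$ (called an abelian complex structure).
   Context: Vector spaces are finite-dimensional over $\mathbb R$ or $\mathbb C$; ''real'' means over $\mathbb R$. A $3$-Hom-L-dendriform algebra is a tuple $(A,\nwarrow,\nearrow,\alpha)$ where $A$ is a vector space, $\nwarrow,\nearrow:\otimes^3A\to A$ and $\alpha:A\to A$ are linear, $\alpha$ is multiplicative (i.e. $\alpha(\nwarrow(x,y,z))=\nwarrow(\alpha(x),\alpha(y),\alpha(z))$ and likewise for $\nearrow$), and, writing $\{x,y,z\}^h=\nwarrow(x,y,z)+\nearrow(x,y,z)-\nearrow(y,x,z)$, $\{x,y,z\}^v=\nwarrow(x,y,z)+\nearrow(z,x,y)-\nearrow(z,y,x)$, $[x,y,z]^C=\{x,y,z\}^h+\{y,z,x\}^h+\{z,x,y\}^h$ (equal to the same cyclic sum of $\{\cdot,\cdot,\cdot\}^v$), the following hold for all $x_1,\dots,x_5\in A$ (where $\circlearrowleft_{1,2,3}$ is the sum over cyclic permutations of the indices $1,2,3$): (0) $\nwarrow(x_1,x_2,x_3)+\nwarrow(x_2,x_1,x_3)=0$;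 (1) $\nwarrow(\alpha(x_1),\alpha(x_2),\nwarrow(x_3,x_4,x_5))-\nwarrow(\alpha(x_3),\alpha(x_4),\nwarrow(x_1,x_2,x_5))=\nwarrow([x_1,x_2,x_3]^C,\alpha(x_4),\alpha(x_5))-\nwarrow([x_1,x_2,x_4]^C,\alpha(x_3),\alpha(x_5))$; (2) $\nwarrow(\alpha(x_1),\alpha(x_2),\nearrow(x_5,x_3,x_4))-\nearrow(\alpha(x_5),\alpha(x_3),\{x_1,x_2,x_4\}^h)=\nearrow(\alpha(x_5),[x_1,x_2,x_3]^C,\alpha(x_4))+\nearrow(\{x_1,x_2,x_5\}^v,\alpha(x_3),\alpha(x_4))$; (3) $\nearrow(\alpha(x_5),\alpha(x_1),\{x_2,x_3,x_4\}^h)-\nwarrow(\alpha(x_2),\alpha(x_3),\nearrow(x_5,x_1,x_4))=\nearrow(\{x_1,x_2,x_5\}^v,\alpha(x_3),\alpha(x_4))-\nearrow(\{x_1,x_3,x_5\}^v,\alpha(x_2),\alpha(x_4))$; (4) $\nwarrow([x_1,x_2,x_3]^C,\alpha(x_4),\alpha(x_5))=\circlearrowleft_{1,2,3}\nwarrow(\alpha(x_1),\alpha(x_2),\nwarrow(x_3,x_4,x_5))$; (5) $\nearrow(\alpha(x_5),[x_1,x_2,x_3]^C,\alpha(x_4))=\circlearrowleft_{1,2,3}\nwarrow(\alpha(x_1),\alpha(x_2),\nearrow(x_5,x_3,x_4))$; (6) $\nwarrow(\alpha(x_1),\alpha(x_2),\nearrow(x_5,x_3,x_4))+\nearrow(\alpha(x_5),\alpha(x_1),\{x_2,x_3,x_4\}^h)=\nearrow(\alpha(x_5),\alpha(x_2),\{x_1,x_3,x_4\}^h)+\nearrow(\{x_1,x_2,x_5\}^v,\alpha(x_3),\alpha(x_4))$.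 A complex structure on $A$ is a linear map $J:A\to A$ with $J^2=-\mathrm{id}_A$ which is a Nijenhuis operator; equivalently $J^2=-\mathrm{id}_A$, $J\alpha=\alpha J$ and, for $\ast\in\{\nwarrow,\nearrow\}$ and all $x,y,z\in A$, $$J\ast(x,y,z)=-\ast(Jx,Jy,Jz)+\ast(Jx,y,z)+\ast(x,Jy,z)+\ast(x,y,Jz)+J\ast(Jx,Jy,z)+J\ast(x,Jy,Jz)+J\ast(Jx,y,Jz).$$ *)

(* Defs.v *)
From HB Require Import structures.
From mathcomp Require Import all_boot all_order all_algebra.
From mathcomp Require Import reals.

Set Implicit Arguments.
Unset Strict Implicit.
Unset Printing Implicit Defensive.

Import GRing.Theory.
Local Open Scope ring_scope.

Section Definitions.
Variables (K : fieldType) (A : vectType K).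
Implicit Types (f nw ne : A -> A -> A -> A) (J N al : A -> A).

(* Linear maps out of the third tensor power of A, in curried form. *)
Definition trilinear f : Prop :=
  [/\ forall y z, linear (fun x => f x y z),
      forall x z, linear (fun y => f x y z)
    & forall x y, linear (fun z => f x y z)].

Definition multiplicative3 al f : Prop :=
  forall x y z, al (f x y z) = f (al x) (al y) (al z).

Definition hbracket nw ne x y z : A := nw x y z + ne x y z - ne y x z.

Definition vbracket nw ne x y z : A := nw x y z + ne z x y - ne z y x.

Definition Cbracket nw ne x y z : A :=
  hbracket nw ne x y z + hbracket nw ne y z x + hbracket nw ne z x y.

Lemma Cbracket_vbracket nw ne x y z :
  Cbracket nw ne x y z =
  vbracket nw ne x y z + vbracket nw ne y z x + vbracket nw ne z x y.
Proof.
rewrite /Cbracket /hbracket /vbracket.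
rewrite !addrA.
rewrite [LHS](AC (9) (1*4*7*(2*5*8)*(3*6*9))).
by rewrite [RHS](AC (9) (1*4*7*(5*8*2)*(9*3*6))).
Qed.

(* 3-Hom-L-dendriform algebra structures on A; [nw] and [ne] are the
   operations written \nwarrow and \nearrow, [alpha] is the twisting map. *)
Record homLdendriform3 := HomLDendriform3 {
  nw : A -> A -> A -> A;
  ne : A -> A -> A -> A;
  alpha : {linear A -> A};
  nw_trilinear : trilinear nw;
  ne_trilinear : trilinear ne;
  nw_multiplicative : multiplicative3 alpha nw;
  ne_multiplicative : multiplicative3 alpha ne;
  nw_skew : forall x1 x2 x3, nw x1 x2 x3 + nw x2 x1 x3 = 0;
  homLdend_ax1 : forall x1 x2 x3 x4 x5,
    nw (alpha x1) (alpha x2) (nw x3 x4 x5)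
      - nw (alpha x3) (alpha x4) (nw x1 x2 x5) =
    nw (Cbracket nw ne x1 x2 x3) (alpha x4) (alpha x5)
      - nw (Cbracket nw ne x1 x2 x4) (alpha x3) (alpha x5);
  homLdend_ax2 : forall x1 x2 x3 x4 x5,
    nw (alpha x1) (alpha x2) (ne x5 x3 x4)
      - ne (alpha x5) (alpha x3) (hbracket nw ne x1 x2 x4) =
    ne (alpha x5) (Cbracket nw ne x1 x2 x3) (alpha x4)
      + ne (vbracket nw ne x1 x2 x5) (alpha x3) (alpha x4);
  homLdend_ax3 : forall x1 x2 x3 x4 x5,
    ne (alpha x5) (alpha x1) (hbracket nw ne x2 x3 x4)
      - nw (alpha x2) (alpha x3) (ne x5 x1 x4) =
    ne (vbracket nw ne x1 x2 x5) (alpha x3) (alpha x4)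
      - ne (vbracket nw ne x1 x3 x5) (alpha x2) (alpha x4);
  homLdend_ax4 : forall x1 x2 x3 x4 x5,
    nw (Cbracket nw ne x1 x2 x3) (alpha x4) (alpha x5) =
    nw (alpha x1) (alpha x2) (nw x3 x4 x5)
      + nw (alpha x2) (alpha x3) (nw x1 x4 x5)
      + nw (alpha x3) (alpha x1) (nw x2 x4 x5);
  homLdend_ax5 : forall x1 x2 x3 x4 x5,
    ne (alpha x5) (Cbracket nw ne x1 x2 x3) (alpha x4) =
    nw (alpha x1) (alpha x2) (ne x5 x3 x4)
      + nw (alpha x2) (alpha x3) (ne x5 x1 x4)
      + nw (alpha x3) (alpha x1) (ne x5 x2 x4);
  homLdend_ax6 : forall x1 x2 x3 x4 x5,
    nw (alpha x1) (alpha x2) (ne x5 x3 x4)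
      + ne (alpha x5) (alpha x1) (hbracket nw ne x2 x3 x4) =
    ne (alpha x5) (alpha x2) (hbracket nw ne x1 x3 x4)
      + ne (vbracket nw ne x1 x2 x5) (alpha x3) (alpha x4)
}.

(* The vanishing of the ternary Nijenhuis torsion of N with respect to f. *)
Definition nijenhuis_for f N : Prop := forall x y z,
  f (N x) (N y) (N z) =
    N (f (N x) (N y) z + f x (N y) (N z) + f (N x) y (N z))
    - N (N (f (N x) y z + f x (N y) z + f x y (N z)))
    + N (N (N (f x y z))).

Definition nijenhuis (L : homLdendriform3) (N : {linear A -> A}) : Prop :=
  [/\ forall x, N (alpha L x) = alpha L (N x),
      nijenhuis_for (nw L) N & nijenhuis_for (ne L) N].

Definition almost_complex J : Prop := forall x, J (J x) = - x.

Definition complex_structure (L : homLdendriform3) (J : {linear A -> A}) :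
  Prop := almost_complex J /\ nijenhuis L J.

(* For J^2 = - id, the terms J^2 and J^3 collapse to this identity. *)
Definition complex_integrable f J : Prop := forall x y z,
  J (f x y z) =
    - f (J x) (J y) (J z) + f (J x) y z + f x (J y) z + f x y (J z)
    + J (f (J x) (J y) z) + J (f x (J y) (J z)) + J (f (J x) y (J z)).

Lemma nijenhuis_for_complexE f (J : {linear A -> A}) :
  almost_complex J -> nijenhuis_for f J <-> complex_integrable f J.
Proof.
move=> J2.
have regroup t p q r a b c : - t + p + q + r + a + b + c =
    (a + b + c) + (p + q + r) - t :> A.
  by rewrite !addrA [LHS](AC 7 (5*6*7*2*3*4*1)).
split=> H x y z; move: (H x y z); rewrite !J2 opprK !linearD regroup => E.
  by rewrite E opprB addrC subrK.
by rewrite E opprB addrC subrK.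
Qed.

End Definitions.

(* Main.v *)
(* Evaluating the abelian identity at (Jx, Jy, Jz), with J^2 = -1, gives
   f(Jx, Jy, Jz) = f(Jx, y, z) + f(x, Jy, z) + f(x, y, Jz); applying J to the
   identity itself turns the three remaining terms of the integrability
   condition into J f(x, y, z). *)
Require Import Defs.
From mathcomp Require Import all_boot all_order all_algebra.
From mathcomp Require Import reals.
Import GRing.Theory.
Local Open Scope ring_scope.

(** Sign rules for the minus signs that [J (J x) = - x] creates inside arguments. *)
Lemma trilinearN (K : fieldType) (A : vectType K) (f : A -> A -> A -> A) :
  trilinear f ->
  [/\ forall x y z, f (- x) y z = - f x y z,
      forall x y z, f x (- y) z = - f x y z
    & forall x y z, f x y (- z) = - f x y z].
Proof.
have linN (g : A -> A) : linear g -> forall u, g (- u) = - g u.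
  (* The instance at [u, u] gives [g 0 = - g u + g u]; the one at [u, 0] then gives the claim. *)
  move=> lin_g u; have := lin_g (-1) u u.
  rewrite !scaleN1r addNr => g0; have := lin_g (-1) u 0.
  by rewrite !scaleN1r addr0 g0 addNr addr0.
case=> f1 f2 f3; split=> x y z.
- exact: linN (f1 y z) x.
- exact: linN (f2 x z) y.
- exact: linN (f3 x y) z.
Qed.

(** Stated for one trilinear [f], so that it serves both [nw] and [ne]. *)
Lemma abelian_complex_integrable (K : fieldType) (A : vectType K)
    (f : A -> A -> A -> A) (J : {linear A -> A}) :
  trilinear f -> almost_complex J ->
  (forall x y z, f x y z = f x (J y) (J z) + f (J x) y (J z) + f (J x) (J y) z) ->
  complex_integrable f J.
Proof.
move=> /trilinearN[fN1 fN2 fN3] J2 f_abelian x y z.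
have ->: f (J x) (J y) (J z) = f (J x) y z + f x (J y) z + f x y (J z).
  (* Each term has two arguments of the form [J (J u)], so its signs cancel. *)
  by rewrite f_abelian !J2 !(fN1, fN2, fN3) !opprK.
set p := f (J x) y z; set q := f x (J y) z; set r := f x y (J z).
(* [- (p + q + r)] cancels [p + q + r]; only the terms under [J] remain. *)
rewrite -(addrA _ p q) -(addrA _ _ r) addNr add0r.
by rewrite [in LHS]f_abelian !linearD [LHS]addrC addrA.
Qed.

Theorem lemma4p16 (R : realType) (A : vectType R) (L : homLdendriform3 A)
  (J : {linear A -> A})
  (J_almost_complex : almost_complex J)
  (J_alpha : forall x : A, J (alpha L x) = alpha L (J x))
  (nw_abelian : forall x y z : A,
    nw L x y z = nw L x (J y) (J z) + nw L (J x) y (J z) + nw L (J x) (J y) z)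
  (ne_abelian : forall x y z : A,
    ne L x y z = ne L x (J y) (J z) + ne L (J x) y (J z) + ne L (J x) (J y) z) :
  complex_structure L J.
Proof.
(* What remains is the torsion of each operation, traded for integrability through [J^2 = -1]. *)
split=> //; split=> //; apply/nijenhuis_for_complexE => //.
- exact: abelian_complex_integrable (nw_trilinear L) J_almost_complex nw_abelian.
- exact: abelian_complex_integrable (ne_trilinear L) J_almost_complex ne_abelian.
Qed.
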